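(* Let $G$ be a nilpotent group and let $$S=\{w_1(x_1,\dots,x_n,y_1,\dots,y_m)=1,\ \dots,\ w_n(x_1,\dots,x_n,y_1,\dots,y_m)=1\}$$ be a system of equations over $G$, where $w_j\in G*F(x_1,\dots,x_n,y_1,\dots,y_m)$, such that the determinant of the $n\times n$ integer matrix composed of the exponent sums of the unknowns $x_i$ ($1\le i\le n$) in the words $w_j$ ($1\le j\le n$) is one. Then there exist words $v_1(y_1,\dots,y_m),\dots,v_n(y_1,\dots,y_m)\in G*F(y_1,\dots,y_m)$ such that the set of all solutions to $S$ in $G$ is $$\bigl\{(\tilde x_1,\dots,\tilde x_n,\tilde y_1,\dots,\tilde y_m)\in G^{n+m}\ \big|\ \tilde x_1=v_1(\tilde y_1,\dots,\tilde y_m),\ \dots,\ \tilde x_n=v_n(\tilde y_1,\dots,\tilde y_m)\bigr\}.$$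
   Context: $F(z_1,\dots,z_k)$ denotes the free group with basis $z_1,\dots,z_k$, and $*$ denotes the free product. For a word $w\in G*F(z_1,\dots,z_k)$ and elements $g_1,\dots,g_k\in G$, $w(g_1,\dots,g_k)\in G$ is the result of substituting $g_i$ for $z_i$. A solution to $S$ in $G$ is a tuple in $G^{n+m}$ whose substitution for $(x_1,\dots,x_n,y_1,\dots,y_m)$ makes every $w_j$ equal to $1$. *)

(* Defs.v *)
From HB Require Import structures.
From mathcomp Require Import all_boot all_order all_algebra.
From mathcomp Require Import boolp classical_sets.

Set Implicit Arguments.
Unset Strict Implicit.
Unset Printing Implicit Defensive.

Import GRing.Theory.
Local Open Scope group_scope.
Local Open Scope quotient_scope.
Local Open Scope classical_set_scope.

Section Nilpotent.
Variable G : groupType.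

Definition subgroup (H : set G) : Prop :=
  H 1 /\ (forall x y, H x -> H y -> H (x / y)).

(* Indexed from 0: [lower_central c] is the subgroup usually written
   gamma_(c+1), and [smallest subgroup A] is the subgroup generated by A. *)
Fixpoint lower_central (c : nat) : set G :=
  if c is c'.+1 then
    smallest subgroup [set z | exists x y, lower_central c' x /\ z = [~ x, y]]
  else setT.

Definition nilpotent_group : Prop := exists c, lower_central c = [set 1].

End Nilpotent.

(* G * F(z_1, ..., z_k), as the quotient of the words in the letters g (in G),
   z_i and z_i^-1 by the congruence generated by the multiplication of G and
   free cancellation.  [inr (i, false)] stands for z_i, [inr (i, true)] for
   z_i^-1. *)
Section FreeProduct.
Variables (G : groupType) (k : nat).

Notation letter := (G + 'I_k * bool)%type.

Inductive word_eqv : seq letter -> seq letter -> Prop :=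
| Word_refl u : word_eqv u u
| Word_sym u v : word_eqv u v -> word_eqv v u
| Word_trans u v w : word_eqv u v -> word_eqv v w -> word_eqv u w
| Word_cat u u' v v' :
    word_eqv u u' -> word_eqv v v' -> word_eqv (u ++ v) (u' ++ v')
| Word_mul g h : word_eqv [:: inl g; inl h] [:: inl (g * h)]
| Word_one : word_eqv [:: inl 1] [::]
| Word_cancel i b : word_eqv [:: inr (i, b); inr (i, ~~ b)] [::].

Definition word_eqvb (u v : seq letter) : bool := `[< word_eqv u v >].

Lemma word_eqvb_refl : reflexive word_eqvb.
Proof. by move=> u; apply/asboolP; apply: Word_refl. Qed.

Lemma word_eqvb_sym : symmetric word_eqvb.
Proof. by move=> u v; apply/asboolP/asboolP; apply: Word_sym. Qed.

Lemma word_eqvb_trans : transitive word_eqvb.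
Proof.
by move=> v u w /asboolP uv /asboolP vw; apply/asboolP; apply: Word_trans uv vw.
Qed.

Canonical word_equiv :=
  EquivRel word_eqvb word_eqvb_refl word_eqvb_sym word_eqvb_trans.

Definition freeprod : Type := {eq_quot word_equiv}.
HB.instance Definition _ := Choice.on freeprod.

Definition fp_class (u : seq letter) : freeprod := \pi_{eq_quot word_equiv} u.
Definition fp_repr (x : freeprod) : seq letter :=
  repr (x : {eq_quot word_equiv}).

Lemma fp_reprK x : fp_class (fp_repr x) = x.
Proof. exact: reprK. Qed.

Lemma fp_classP u v : fp_class u = fp_class v <-> word_eqv u v.
Proof. by split => [/eqmodP/asboolP//|uv]; apply/eqmodP/asboolP. Qed.

Lemma fp_repr_eqv u : word_eqv (fp_repr (fp_class u)) u.
Proof. by apply/fp_classP; rewrite fp_reprK. Qed.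

Definition letter_inv (a : letter) : letter :=
  match a with inl g => inl g^-1 | inr (i, b) => inr (i, ~~ b) end.

Definition word_inv (u : seq letter) : seq letter := rev (map letter_inv u).

Lemma word_inv_cat u v : word_inv (u ++ v) = word_inv v ++ word_inv u.
Proof. by rewrite /word_inv map_cat rev_cat. Qed.

Lemma word_inv_eqv u v : word_eqv u v -> word_eqv (word_inv u) (word_inv v).
Proof.
elim=> {u v} [u|u v _ uv|u v w _ uv _ vw|u u' v v' _ uu' _ vv'|g h||i b].
- exact: Word_refl.
- exact: Word_sym.
- exact: Word_trans uv vw.
- by rewrite !word_inv_cat; apply: Word_cat.
- by rewrite /word_inv /= invgM; apply: Word_mul.
- by rewrite /word_inv /= invg1; apply: Word_one.
- by rewrite /word_inv /rev /= negbK; apply: Word_cancel.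
Qed.

Lemma letter_invK : involutive letter_inv.
Proof. by case=> [g|[i b]] /=; rewrite ?invgK ?negbK. Qed.

Lemma word_invK : involutive word_inv.
Proof.
by move=> u; rewrite /word_inv map_rev revK mapK //; apply: letter_invK.
Qed.

Lemma word_mulV u : word_eqv (u ++ word_inv u) [::].
Proof.
elim: u => [|a u IH]; first exact: Word_refl.
rewrite -cat1s word_inv_cat -catA [u ++ _]catA.
apply: (@Word_trans _ ([:: a] ++ ([::] ++ word_inv [:: a]))).
  by apply/Word_cat/Word_cat; [apply: Word_refl|apply: IH|apply: Word_refl].
case: a => [g|[i b]]; last exact: Word_cancel.
by apply: Word_trans (Word_mul _ _) _; rewrite mulgV; apply: Word_one.
Qed.

Lemma word_mulVl u : word_eqv (word_inv u ++ u) [::].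
Proof. by have := word_mulV (word_inv u); rewrite word_invK. Qed.

Definition fp_one : freeprod := fp_class [::].
Definition fp_inv (x : freeprod) : freeprod :=
  fp_class (word_inv (fp_repr x)).
Definition fp_mul (x y : freeprod) : freeprod :=
  fp_class (fp_repr x ++ fp_repr y).

Lemma fp_mul_pi u v : fp_mul (fp_class u) (fp_class v) = fp_class (u ++ v).
Proof. by apply/fp_classP/Word_cat; apply: fp_repr_eqv. Qed.

Lemma fp_inv_pi u : fp_inv (fp_class u) = fp_class (word_inv u).
Proof. by apply/fp_classP/word_inv_eqv/fp_repr_eqv. Qed.

Lemma fp_mulA : associative fp_mul.
Proof.
move=> x y z; rewrite -[x]fp_reprK -[y]fp_reprK -[z]fp_reprK.
rewrite (fp_mul_pi (fp_repr x) (fp_repr y)) (fp_mul_pi (fp_repr y)).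
by rewrite !fp_mul_pi catA.
Qed.

Lemma fp_mul1 : left_id fp_one fp_mul.
Proof. by move=> x; rewrite -[x]fp_reprK fp_mul_pi. Qed.

Lemma fp_mul1r : right_id fp_one fp_mul.
Proof. by move=> x; rewrite -[x]fp_reprK fp_mul_pi cats0. Qed.

Lemma fp_mulV : left_inverse fp_one fp_inv fp_mul.
Proof.
move=> x; rewrite -[x]fp_reprK fp_inv_pi fp_mul_pi.
by apply/fp_classP/word_mulVl.
Qed.

Lemma fp_mulVr : right_inverse fp_one fp_inv fp_mul.
Proof.
move=> x; rewrite -[x]fp_reprK fp_inv_pi fp_mul_pi.
by apply/fp_classP/word_mulV.
Qed.

HB.instance Definition _ :=
  isGroup.Build freeprod fp_mulA fp_mul1 fp_mul1r fp_mulV fp_mulVr.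

Lemma fp_classM u v : fp_class (u ++ v) = fp_class u * fp_class v.
Proof. by symmetry; exact: fp_mul_pi. Qed.

Lemma fp_classV u : fp_class (word_inv u) = (fp_class u)^-1.
Proof. by symmetry; exact: fp_inv_pi. Qed.

Definition fp_const (g : G) : freeprod := fp_class [:: inl g].
Definition fp_gen (i : 'I_k) : freeprod := fp_class [:: inr (i, false)].

Definition letter_val (H : groupType) (f : G -> H) (h : 'I_k -> H)
    (a : letter) : H :=
  match a with
  | inl g => f g
  | inr (i, b) => if b then (h i)^-1 else h i
  end.

(* The homomorphism out of G * F(z_1, ..., z_k) that restricts to [f] on G and
   sends z_i to [h i]; meaningful when [f] is a homomorphism, in which case the
   value does not depend on the representative ([fp_lift_class]). *)
Definition fp_lift (H : groupType) (f : G -> H) (h : 'I_k -> H)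
    (w : freeprod) : H :=
  \prod_(a <- fp_repr w) letter_val f h a.

Definition subst (g : 'I_k -> G) (w : freeprod) : G := fp_lift id g w.

Definition letter_exponent (i : 'I_k) (a : letter) : int :=
  match a with
  | inl _ => 0
  | inr (j, b) => if j == i then (if b then -1 else 1) else 0
  end%R.

(* Independent of the representative, by [exponent_sum_class]. *)
Definition exponent_sum (w : freeprod) (i : 'I_k) : int :=
  (\sum_(a <- fp_repr w) letter_exponent i a)%R.

Lemma fp_lift_class (H : groupType) (f : G -> H) (h : 'I_k -> H) u :
  {morph f : x y / x * y} ->
  fp_lift f h (fp_class u) =
  \prod_(a <- u) letter_val f h a.
Proof.
move=> fM; have f1 : f 1 = 1.
  by apply: (mulgI (f 1)); rewrite -fM !mulg1.
rewrite /fp_lift; move: (fp_repr_eqv u).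
move: (fp_repr _) => v; elim=> {u v} //.
- by move=> u v w _ -> _ ->.
- by move=> u u' v v' _ uu' _ vv'; rewrite !big_cat /= uu' vv'.
- by move=> g g'; rewrite !big_cons big_nil /= !mulg1 fM.
- by rewrite big_cons !big_nil /= mulg1.
- by move=> i b; rewrite !big_cons big_nil /= mulg1; case: b;
    rewrite ?mulgV ?mulVg.
Qed.

Lemma fp_liftM (H : groupType) (f : G -> H) (h : 'I_k -> H) :
  {morph f : x y / x * y} -> {morph fp_lift f h : x y / x * y}.
Proof.
move=> fM x y; rewrite -[x]fp_reprK -[y]fp_reprK.
rewrite -fp_classM.
by rewrite !fp_lift_class // big_cat.
Qed.

Lemma fp_lift_const (H : groupType) (f : G -> H) (h : 'I_k -> H) g :
  {morph f : x y / x * y} -> fp_lift f h (fp_const g) = f g.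
Proof. by move=> fM; rewrite fp_lift_class // big_cons big_nil mulg1. Qed.

Lemma fp_lift_gen (H : groupType) (f : G -> H) (h : 'I_k -> H) i :
  {morph f : x y / x * y} -> fp_lift f h (fp_gen i) = h i.
Proof. by move=> fM; rewrite fp_lift_class // big_cons big_nil mulg1. Qed.

Lemma fp_constM : {morph fp_const : x y / x * y}.
Proof.
move=> g h; rewrite /fp_const -fp_classM.
by apply/fp_classP/Word_sym/Word_mul.
Qed.

Lemma fp_lift_uniq (H : groupType) (F F' : freeprod -> H) :
  {morph F : x y / x * y} -> {morph F' : x y / x * y} ->
  (forall g, F (fp_const g) = F' (fp_const g)) ->
  (forall i, F (fp_gen i) = F' (fp_gen i)) -> F =1 F'.
Proof.
move=> FM F'M Fc Fg.
have F1 (E : freeprod -> H) : {morph E : x y / x * y} -> E 1 = 1.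
  by move=> EM; apply: (mulgI (E 1)); rewrite -EM !mulg1.
have FV (E : freeprod -> H) x : {morph E : x y / x * y} -> E x^-1 = (E x)^-1.
  by move=> EM; apply: (mulgI (E x)); rewrite -EM !mulgV F1.
move=> x; rewrite -[x]fp_reprK; elim: (fp_repr x) => [|a u IH].
  by change (F 1 = F' 1); rewrite !F1.
rewrite -cat1s fp_classM FM F'M IH; congr (_ * _).
case: a => [g|[i []]]; [exact: Fc| |exact: Fg].
have -> : fp_class [:: inr (i, true)] = (fp_gen i)^-1 by rewrite -fp_classV.
by rewrite !FV // Fg.
Qed.

Lemma exponent_sum_class u i :
  exponent_sum (fp_class u) i =
  (\sum_(a <- u) letter_exponent i a)%R.
Proof.
rewrite /exponent_sum; move: (fp_repr_eqv u).
move: (fp_repr _) => v; elim=> {u v} //.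
- by move=> u v w _ -> _ ->.
- by move=> u u' v v' _ uu' _ vv'; rewrite !big_cat /= uu' vv'.
- by move=> g g'; rewrite !big_cons big_nil /= !addr0.
- by rewrite big_cons !big_nil /= addr0.
- by move=> j b; rewrite !big_cons big_nil /= addr0; case: eqP => _;
    rewrite ?addr0 //; case: b.
Qed.

Lemma exponent_sumM (x y : freeprod) i :
  exponent_sum (x * y) i = (exponent_sum x i + exponent_sum y i)%R.
Proof.
rewrite -[x]fp_reprK -[y]fp_reprK.
rewrite -fp_classM.
by rewrite !exponent_sum_class big_cat.
Qed.

Lemma exponent_sum_const g i : exponent_sum (fp_const g) i = 0%R.
Proof. by rewrite exponent_sum_class big_cons big_nil /= addr0. Qed.

Lemma exponent_sum_gen j i : exponent_sum (fp_gen j) i = (j == i)%:R%R.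
Proof.
by rewrite exponent_sum_class big_cons big_nil /= addr0; case: eqP.
Qed.

End FreeProduct.

Definition solutions (G : groupType) (r k : nat) (w : 'I_r -> freeprod G k) :
    set (k.-tuple G) :=
  [set t | forall j, subst (tnth t) (w j) = 1].

(* Main.v *)
(** Raising the words w_l to the entries of the inverse of the exponent matrix
    turns the system into x_j = u_j(x, y), where every u_j has exponent sum
    zero in each x_i.  If x and x' agree modulo a term of the lower central
    series, then u(x, y) and u(x', y) agree modulo the next one: x |-> u(x, y)
    is a contraction.  By nilpotency its iterates on 1 stabilise, and they are
    values of words in y; the fixed point is unique.  The same uniqueness,
    applied to a combined system in the values of the w_l, shows that the
    transformed system has no more solutions than the original one. *)

Require Import Defs.
From mathcomp Require Import all_boot all_order all_algebra.
From mathcomp Require Import boolp classical_sets.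

Set Implicit Arguments.
Unset Strict Implicit.
Unset Printing Implicit Defensive.

Import GRing.Theory.

(** * Congruence modulo the lower central series *)

Section LowerCentral.
Local Open Scope group_scope.
Local Open Scope classical_set_scope.
Variable G : groupType.
Implicit Types (x y z : G) (k : nat).

Lemma lower_central_subgroup k : subgroup (lower_central (G := G) k).
Proof.
case: k => [|k]; first by split.
split=> [H [[] //]|x y Hx Hy H HH].
by case: (HH) => [[_ HV] _]; apply: HV; [apply: Hx|apply: Hy].
Qed.

Lemma lower_central1 k : lower_central (G := G) k 1.
Proof. by case: (lower_central_subgroup k). Qed.

Lemma lower_centralV k x : lower_central k x -> lower_central k x^-1.
Proof.
case: (lower_central_subgroup k) => H1 HV Hx.
by have := HV _ _ H1 Hx; rewrite mul1g.
Qed.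

Lemma lower_centralM k x y :
  lower_central k x -> lower_central k y -> lower_central k (x * y).
Proof.
case: (lower_central_subgroup k) => H1 HV Hx /lower_centralV Hy.
by have := HV _ _ Hx Hy; rewrite invgK.
Qed.

Lemma lower_central_comm k x y :
  lower_central k x -> lower_central k.+1 [~ x, y].
Proof. by move=> Hx H [_]; apply; exists x, y. Qed.

Lemma lower_central_decr k x : lower_central k.+1 x -> lower_central k x.
Proof.
elim: k x => [//|k IH] x Hx H [Hs HH]; apply: Hx; split=> // _ [a [b [Ha ->]]].
by apply: HH; exists a, b; split=> //; apply: IH.
Qed.

Lemma lower_centralJ k x y : lower_central k x -> lower_central k (x ^ y).
Proof.
move=> Hx; have -> : x ^ y = x * [~ x, y] by rewrite commgEl mulVKg.
exact: lower_centralM Hx (lower_central_decr (lower_central_comm _ Hx)).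
Qed.

(** Equality in the quotient by [lower_central k]. It always holds for k = 0, which is where the
    inductions start. *)
Definition lc_eqv k x y : Prop := lower_central k (x^-1 * y).

Lemma lc_eqv_refl k x : lc_eqv k x x.
Proof. by rewrite /lc_eqv mulVg; apply: lower_central1. Qed.

Lemma lc_eqv_trans k y x z : lc_eqv k x y -> lc_eqv k y z -> lc_eqv k x z.
Proof.
by move=> xy yz; have := lower_centralM xy yz; rewrite /lc_eqv mulgA mulgK.
Qed.

Lemma lc_eqvM k x x' y y' :
  lc_eqv k x x' -> lc_eqv k y y' -> lc_eqv k (x * y) (x' * y').
Proof.
move=> xx' yy'; have := lower_centralM (lower_centralJ y xx') yy'.
by rewrite /lc_eqv conjgE invgM !mulgA mulgK.
Qed.

(** The two products differ by the commutator [[~ x, y]], which lies in the next term. *)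
Lemma lc_eqvC k x y : lower_central k x -> lc_eqv k.+1 (y * x) (x * y).
Proof.
move=> Hx; have := lower_central_comm y Hx.
by rewrite /lc_eqv invgM commgEl conjgE !mulgA.
Qed.

End LowerCentral.

(** * Integer powers *)

Section IntegerPower.
Local Open Scope group_scope.

Definition expgz (G : groupType) (x : G) (z : int) : G :=
  match z with Posz n => x ^+ n | Negz n => x ^- n.+1 end.

Lemma expgzS (G : groupType) (x : G) z : x * expgz x z = expgz x (1 + z)%R.
Proof.
case: z => [n|[|n]] /=; first by rewrite -expgS.
  by rewrite expg1 mulgV subnn.
by rewrite subn1 /= expgSr invgM mulVKg.
Qed.

Lemma expgzV (G : groupType) (x : G) z : x^-1 * expgz x z = expgz x (-1 + z)%R.
Proof. by apply: (mulgI x); rewrite expgzS addNKr mulVKg. Qed.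

Lemma expgz1 (G : groupType) z : expgz (1 : G) z = 1.
Proof. by case: z => n; rewrite /expgz expg1n ?invg1. Qed.

Section Morphism.
Variables (G H : groupType) (f : G -> H).
Hypothesis fM : {morph f : x y / x * y}.

Lemma morph_1 : f 1 = 1.
Proof. by apply: (mulgI (f 1)); rewrite -fM !mulg1. Qed.

Lemma morph_V x : f x^-1 = (f x)^-1.
Proof. by apply: (mulgI (f x)); rewrite -fM !mulgV morph_1. Qed.

Lemma morph_expgz x z : f (expgz x z) = expgz (f x) z.
Proof.
have fX n : f (x ^+ n) = f x ^+ n.
  by elim: n => [|n IH]; [exact: morph_1|rewrite !expgS fM IH].
by case: z => n; rewrite /expgz ?morph_V fX.
Qed.

End Morphism.
End IntegerPower.

(** * Exponent sums and substitution *)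

Section Exponents.
Local Open Scope group_scope.
Variables (G : groupType) (k : nat).
Implicit Types (w : freeprod G k) (i : 'I_k) (t : 'I_k -> G).

Lemma exponent_sum1 i : exponent_sum (1 : freeprod G k) i = 0%R.
Proof. by rewrite [LHS]exponent_sum_class big_nil. Qed.

Lemma exponent_sumV w i : exponent_sum w^-1 i = (- exponent_sum w i)%R.
Proof.
by apply/eqP; rewrite -addr_eq0 -exponent_sumM mulVg exponent_sum1.
Qed.

Lemma exponent_sum_expgz w z i :
  exponent_sum (expgz w z) i = (z * exponent_sum w i)%R.
Proof.
have eX n : exponent_sum (w ^+ n) i = (n%:Z * exponent_sum w i)%R.
  elim: n => [|n IH]; first by rewrite mul0r exponent_sum1.
  by rewrite expgS exponent_sumM IH intS mulrDl mul1r.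
by case: z => n; rewrite /expgz ?exponent_sumV eX // NegzE mulNr.
Qed.

Lemma exponent_sum_prod n (w : 'I_n -> freeprod G k) i :
  exponent_sum (\prod_j w j) i = (\sum_j exponent_sum (w j) i)%R.
Proof.
apply: (big_morph (fun x => exponent_sum x i)) => [x y|]; first exact: exponent_sumM.
exact: exponent_sum1.
Qed.

Lemma substM t : {morph subst t : x y / x * y}.
Proof. exact: fp_liftM. Qed.

Lemma subst_prod t n (w : 'I_n -> freeprod G k) :
  subst t (\prod_j w j) = \prod_j subst t (w j).
Proof. by apply: big_morph; [apply: substM|apply/morph_1/substM]. Qed.

Lemma subst_gen t i : subst t (fp_gen G i) = t i.
Proof. exact: fp_lift_gen. Qed.

(* The quotient z of the two i-th entries is central modulo the next term, so
   its occurrences in the value of [w] can be collected at the end. *)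
Lemma subst_lc_eqv1 c t t' i w :
    lc_eqv c (t i) (t' i) -> (forall j, j != i -> t j = t' j) ->
  lc_eqv c.+1 (subst t w * expgz ((t i)^-1 * t' i) (exponent_sum w i)) (subst t' w).
Proof.
rewrite {1}/lc_eqv; set z := (t i)^-1 * t' i => zc tt'.
have t'i : t' i = t i * z by rewrite mulVKg.
clearbody z.
(* Brings one factor z or z^-1 of the collected power back to the current letter, past the value [v]
   of the remaining letters. *)
have shift (p v y q : G) : lower_central c y ->
    lc_eqv c.+1 (p * v * (y * q)) (p * y * (v * q)).
  move=> yc; rewrite -!mulgA; apply: lc_eqvM; first exact: lc_eqv_refl.
  by rewrite !mulgA; apply: lc_eqvM; [exact: lc_eqvC|exact: lc_eqv_refl].
rewrite -[w]fp_reprK /subst !fp_lift_class // exponent_sum_class.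
elim: (fp_repr w) => [|a u IH]; first by rewrite !big_nil mulg1; apply: lc_eqv_refl.
rewrite !big_cons; case: a => [g|[j b]] /=.
  by rewrite add0r -mulgA; apply: lc_eqvM IH; apply: lc_eqv_refl.
case: eqP => [->|/eqP ji]; last first.
  by rewrite add0r -mulgA tt' //; apply: lc_eqvM IH; apply: lc_eqv_refl.
case: b; rewrite -?expgzS -?expgzV t'i; last first.
  by apply: lc_eqv_trans (shift _ _ _ _ zc) _; apply: lc_eqvM IH; apply: lc_eqv_refl.
(* For an inverse letter the new value is z^-1 (t i)^-1, so z^-1 must also be swapped with (t
   i)^-1. *)
have zVc := lower_centralV zc; rewrite invgM.
apply: lc_eqv_trans (shift _ _ _ _ zVc) _.
apply: lc_eqvM IH.
exact: lc_eqvC zVc.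
Qed.

(** The coordinates in [s] are changed one at a time; their exponent sums vanish, so the correction
    power in [subst_lc_eqv1] is trivial. *)
Lemma subst_lc_eqv c t t' w (s : seq 'I_k) :
    (forall i, i \in s -> exponent_sum w i = 0%R) ->
    (forall i, lc_eqv c (t i) (t' i)) ->
    (forall i, i \notin s -> t i = t' i) ->
  lc_eqv c.+1 (subst t w) (subst t' w).
Proof.
elim: s t => [|i s IH] t w0 tt' tE.
  have -> : t = t' by apply: funext => i; apply: tE.
  exact: lc_eqv_refl.
pose t1 j := if j == i then t' j else t j.
have H1 : lc_eqv c.+1 (subst t w) (subst t1 w).
  have := @subst_lc_eqv1 c t t1 i w; rewrite w0 ?mem_head // mulg1; apply.
    by rewrite /t1 eqxx.
  by move=> j /negPf; rewrite /t1 => ->.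
apply: lc_eqv_trans H1 (IH _ _ _ _) => [j js|j|j js].
- by apply: w0; rewrite inE js orbT.
- by rewrite /t1; case: eqP => // _; apply: lc_eqv_refl.
- by rewrite /t1; case: eqVneq => // ji; apply: tE; rewrite inE negb_or ji.
Qed.

End Exponents.

(** * Equations over a nilpotent group *)

Section Solve.
Local Open Scope group_scope.
Variable G : groupType.
Hypothesis hG : nilpotent_group G.

Lemma lc_eqv_eq (x y : G) : (forall c, lc_eqv c x y) -> x = y.
Proof.
case: hG => c Gc /(_ c); rewrite /lc_eqv Gc => /(congr1 (fun z => x * z)).
by rewrite mulVKg mulg1.
Qed.

(** [H] is arbitrary because the entries are group elements in some uses and words in others. *)
Definition join_val (H : Type) n m (x : 'I_n -> H) (y : 'I_m -> H) (i : 'I_(n + m)) : H :=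
  match split i with inl j => x j | inr l => y l end.

Lemma join_val_eta (H : Type) n m (t : 'I_(n + m) -> H) :
  join_val (fun i => t (lshift m i)) (fun i => t (rshift n i)) = t.
Proof.
by apply: funext => i; rewrite /join_val; case: split_ordP => j ->.
Qed.

(** * Fixed points of x |-> u(x, y) *)

Section FixedPoint.
Variables (n m : nat) (u : 'I_n -> freeprod G (n + m)).
Hypothesis u0 : forall j i, exponent_sum (u j) (lshift m i) = 0%R.

Lemma subst_join_lc_eqv c (x x' : 'I_n -> G) (y : 'I_m -> G) j :
    (forall i, lc_eqv c (x i) (x' i)) ->
  lc_eqv c.+1 (subst (join_val x y) (u j)) (subst (join_val x' y) (u j)).
Proof.
move=> xx'; apply: (@subst_lc_eqv _ _ _ _ _ _ [seq lshift m i | i : 'I_n]).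
- by move=> _ /mapP[i _ ->].
- by move=> i; rewrite /join_val; case: split => l //; apply: lc_eqv_refl.
- move=> i; rewrite /join_val; case: split_ordP => l -> //.
  by rewrite map_f ?mem_enum.
Qed.

(** The contraction gains one term of the series at each step, so two fixed points agree modulo
    every term. *)
Lemma fixed_point_uniq (x x' : 'I_n -> G) (y : 'I_m -> G) :
    (forall i, x i = subst (join_val x y) (u i)) ->
    (forall i, x' i = subst (join_val x' y) (u i)) ->
  x = x'.
Proof.
move=> xE x'E; apply: funext => i; apply: lc_eqv_eq => c.
by elim: c i => [//|c IH] i; rewrite xE x'E; apply: subst_join_lc_eqv.
Qed.

(** The iterates starting from 1, formed in the free product itself so that one word serves all
    values of y. *)
Fixpoint iter_word (c : nat) (j : 'I_n) : freeprod G m :=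
  if c is c'.+1 then
    fp_lift (@fp_const G m) (join_val (iter_word c') (@fp_gen G m)) (u j)
  else 1.

(** Both sides are homomorphisms in the word [u j], so it suffices to compare them on constants and
    generators. *)
Lemma subst_iter_word (y : 'I_m -> G) c j :
  subst y (iter_word c.+1 j) =
  subst (join_val (fun i => subst y (iter_word c i)) y) (u j).
Proof.
pose h := join_val (iter_word c) (@fp_gen G m).
have constM := @fp_constM G m.
apply: (@fp_lift_uniq _ _ _ (fun w => subst y (fp_lift (@fp_const G m) h w))).
- by move=> w w'; rewrite fp_liftM // substM.
- exact: substM.
- by move=> g; rewrite fp_lift_const // /subst !fp_lift_const.
- move=> i; rewrite fp_lift_gen // subst_gen /h /join_val.
  by case: split => l //; rewrite subst_gen.
Qed.

Lemma fixed_point_word : exists v : 'I_n -> freeprod G m,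
  forall t : 'I_(n + m) -> G,
    (forall i, t (lshift m i) = subst t (u i)) <->
    (forall i, t (lshift m i) = subst (fun l => t (rshift n l)) (v i)).
Proof.
(* With [lower_central c] trivial, iterates c and c+1 have equal values, since they agree modulo
   that term. *)
case: (hG) => c Gc; exists (iter_word c) => t.
set y := fun l => _; pose x c i := subst y (iter_word c i).
have x_eqv k i : lc_eqv k (x k i) (x k.+1 i).
  by elim: k i => [//|k IH] i; rewrite /x 2!subst_iter_word; apply: subst_join_lc_eqv.
have xE i : x c i = subst (join_val (x c) y) (u i).
  have := x_eqv c i; rewrite /lc_eqv Gc => /(congr1 (fun z => x c i * z)).
  by rewrite mulVKg mulg1 /x subst_iter_word => <-.
split=> tE i.
  (* The x-part of [t] and the stable iterate are fixed points for the same y, hence equal. *)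
  have tE' j : t (lshift m j) = subst (join_val (fun i => t (lshift m i)) y) (u j).
    by rewrite join_val_eta.
  by rewrite -[LHS]/((fun i => t (lshift m i)) i) (fixed_point_uniq tE' xE).
rewrite tE [LHS]xE; congr subst; rewrite -[RHS]join_val_eta; congr join_val.
by apply: funext => j; rewrite tE.
Qed.

End FixedPoint.

(** * Integer matrices acting on tuples of words *)

Definition word_comb k r s (B : 'M[int]_(r, s)) (w : 'I_s -> freeprod G k) (j : 'I_r) :
  freeprod G k := \prod_i expgz (w i) (B j i).

Lemma exponent_sum_comb k r s (B : 'M[int]_(r, s)) (w : 'I_s -> freeprod G k) j i :
  exponent_sum (word_comb B w j) i = (\sum_l B j l * exponent_sum (w l) i)%R.
Proof.
by rewrite exponent_sum_prod; apply: eq_bigr => l _; rewrite exponent_sum_expgz.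
Qed.

Lemma subst_comb k r s (B : 'M[int]_(r, s)) (w : 'I_s -> freeprod G k) t j :
  subst t (word_comb B w j) = \prod_i expgz (subst t (w i)) (B j i).
Proof.
by rewrite subst_prod; apply: eq_bigr => i _; rewrite morph_expgz //; apply: substM.
Qed.

Lemma subst_comb1 k r s (B : 'M[int]_(r, s)) (w : 'I_s -> freeprod G k) t :
  (forall j, subst t (w j) = 1) -> forall j, subst t (word_comb B w j) = 1.
Proof. by move=> w1 j; rewrite subst_comb big1 // => i _; rewrite w1 expgz1. Qed.

(** The factors need not commute, so the combination [W i] of the generators by B and then A need
    not be z_i, but it has the same exponent sums. It takes the value 1 at [g] and at the trivial
    tuple. Thus z_i / W_i has exponent sums zero and takes the values g_i and 1 there, and g_i = 1
    follows term by term. *)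
Lemma expgz_matrix_eq1 n (A B : 'M[int]_n) (g : 'I_n -> G) :
  (A *m B = 1%:M)%R -> (forall j, \prod_i expgz (g i) (B j i) = 1) ->
  forall i, g i = 1.
Proof.
move=> AB g1 i.
pose W := word_comb A (word_comb B (@fp_gen G n)).
have Wg j : subst g (W j) = 1.
  apply: subst_comb1 => l; rewrite subst_comb -[RHS](g1 l).
  by apply: eq_bigr => p _; rewrite subst_gen.
have W1 j : subst (fun=> 1) (W j) = 1.
  by do 2!apply: subst_comb1 => ?; rewrite subst_gen.
have WE j l : exponent_sum (W j) l = (j == l)%:R%R.
  have := congr1 (fun M : 'M_n => M j l) AB; rewrite !mxE => <-.
  rewrite exponent_sum_comb; apply: eq_bigr => p _; congr (_ * _)%R.
  rewrite exponent_sum_comb (bigD1 l) //= exponent_sum_gen eqxx mulr1 big1 ?addr0 //.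
  by move=> q /negPf ql; rewrite exponent_sum_gen ql mulr0.
apply: lc_eqv_eq => c; elim: c i => [//|c IH] i.
have := @subst_lc_eqv _ _ c g (fun=> 1) (fp_gen G i / W i) (enum 'I_n).
rewrite !substM !(morph_V (substM _)) Wg W1 !subst_gen invg1 !mulg1; apply=> // j.
  by rewrite exponent_sumM exponent_sumV WE exponent_sum_gen subrr.
by rewrite mem_enum.
Qed.

End Solve.

(** * Solving the system *)

Local Open Scope classical_set_scope.
Local Open Scope ring_scope.

(* The unknowns are numbered x_1, ..., x_n (indices [lshift m i]), then
   y_1, ..., y_m (indices [rshift n i]). *)
Theorem mainTheorem4 (G : groupType) (n m : nat)
    (w : 'I_n -> freeprod G (n + m))
    (hG : nilpotent_group G)
    (hw : \det (\matrix_(j < n, i < n) exponent_sum (w j) (lshift m i)) = 1) :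
  exists v : 'I_n -> freeprod G m,
    solutions w =
    [set t : (n + m).-tuple G |
      forall i : 'I_n,
        tnth t (lshift m i) = subst (fun l : 'I_m => tnth t (rshift n l)) (v i)].
Proof.
set A := (\matrix_(j, i) _) in hw.
have BA : \adj A *m A = 1%:M by rewrite mul_adj_mx hw.
have AB : A *m \adj A = 1%:M by rewrite mul_mx_adj hw.
(* The adjugate is the inverse of A, so the exponent matrix of [w'] in the x_i is the identity. *)
pose w' := word_comb (\adj A) w.
have w'E j i : exponent_sum (w' j) (lshift m i) = (j == i)%:R.
  have := congr1 (fun M : 'M_n => M j i) BA; rewrite !mxE => <-.
  by rewrite exponent_sum_comb; apply: eq_bigr => l _; rewrite [A _ _]mxE.
(* x_j = u_j is equivalent to w'_j = 1, and the exponent sum 1 of x_j in w'_j cancels. *)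
pose u j := (fp_gen G (lshift m j) / w' j)%g.
have u0 j i : exponent_sum (u j) (lshift m i) = 0.
  rewrite exponent_sumM exponent_sumV w'E exponent_sum_gen.
  by rewrite (inj_eq (@lshift_inj _ _)) subrr.
have [v vE] := fixed_point_word hG u0; exists v.
apply/seteqP; split => t /=.
  move=> wt; apply/vE => i; rewrite substM (morph_V (substM _)) subst_gen.
  by rewrite (subst_comb1 _ wt) invg1 mulg1.
(* A fixed point only yields w'_j = 1, a relation between powers of the values of the w_l;
   invertibility of the matrix gives back w_l = 1. *)
move=> /vE tE; apply: (expgz_matrix_eq1 hG AB) => j.
rewrite -subst_comb; have := tE j; rewrite substM (morph_V (substM _)) subst_gen.
by move=> /esym/(canRL (mulKg _)); rewrite mulVg => /eqP; rewrite invg_eq1 => /eqP.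
Qed.
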